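(* Let $G$ be a finite group (not necessarily abelian) of order $n$ and let $A_1,\dots,A_m$ be pairwise disjoint subsets of $G$ with sizes $k_1,\dots,k_m$ such that (i) the $A_i$ partition $G^*$, and (ii) every $A_i$ with $|A_i|>1$ has the form $A_i=S_i\setminus\{e\}$ for some subgroup $S_i$ of $G$. Then $\{A_1,\dots,A_m\}$ is a bimodal $(n,m;k_1,\dots,k_m;m-1)$-RWEDF.
   Context: Write $G$ multiplicatively with identity $e$ and $G^*=G\setminus\{e\}$. For $\delta\in G^*$, $N_j(\delta)=|\{(a,b): a\in A_j,\ b\in A_i \text{ for some } i\neq j,\ ab^{-1}=\delta\}|$. The collection is bimodal if $N_j(\delta)\in\{0,k_j\}$ for all $\delta\in G^*$ and all $j$. An $(n,m;k_1,\dots,k_m;\ell)$-RWEDF is a collection of pairwise disjoint subsets with $|A_i|=k_i$ such that $\sum_i \frac{1}{k_i}N_i(\delta)=\ell$ for all $\delta\in G^*$. *)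

(* Defs.v *)
From HB Require Import structures.
From mathcomp Require Import all_boot all_order all_algebra all_fingroup.

Set Implicit Arguments.
Unset Strict Implicit.
Unset Printing Implicit Defensive.

Import GroupScope.

(* N_j(delta) *)
Definition ext_diff_count (gT : finGroupType) (m : nat)
    (A : 'I_m -> {set gT}) (j : 'I_m) (delta : gT) : nat :=
  #|[set p : gT * gT | [&& p.1 \in A j,
       [exists i : 'I_m, (i != j) && (p.2 \in A i)]
       & p.1 * p.2^-1 == delta]]|.

Definition bimodal (gT : finGroupType) (G : {group gT}) (m : nat)
    (A : 'I_m -> {set gT}) : Prop :=
  forall (j : 'I_m) (delta : gT), delta \in G^# ->
    ext_diff_count A j delta = 0%N \/ ext_diff_count A j delta = #|A j|.

(* The parameter l is a rational number, since the weighted sum need not be an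
   integer a priori.  The condition 0 < k i is what gives 1 / k_i a meaning:
   inversion is total here, with 0^-1 = 0. *)
Definition is_RWEDF (gT : finGroupType) (G : {group gT}) (n m : nat)
    (k : 'I_m -> nat) (l : rat) (A : 'I_m -> {set gT}) : Prop :=
  [/\ #|G| = n,
      forall i, A i \subset G,
      forall i j, i != j -> [disjoint A i & A j],
      forall i, (0 < k i)%N /\ #|A i| = k i
    & forall delta : gT, delta \in G^# ->
        (\sum_(i < m) (k i)%:R^-1 * (ext_diff_count A i delta)%:R)%R = l].

(* Main.v *)
Require Import Defs.
From HB Require Import structures.
From mathcomp Require Import all_boot all_order all_algebra all_fingroup.

Set Implicit Arguments.
Unset Strict Implicit.
Unset Printing Implicit Defensive.

Import GroupScope.

(** For [a] in [A j] and [delta != 1], the element [b = delta^-1 * a] lies in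
    [1 |: A j] exactly when [delta] lies in [A j]: this is clear when [1 |: A j]
    is a subgroup, and also when [A j] is a singleton. Hence the
    representations [delta = a * b^-1] counted by [N_j(delta)] number [0] if
    [delta] is in [A j] and [#|A j|] otherwise; as [delta] lies in exactly one
    block, the weighted sum is [m - 1]. *)

Lemma setD1_group_mem_divl (gT : finGroupType) (B : {set gT}) (a d : gT) :
    (1 < #|B| -> exists S : {group gT}, B = S^#) ->
  a \in B -> d != 1 -> (d^-1 * a \in 1 |: B) = (d \in B).
Proof.
move=> subB Ba nt_d; have [/subB[S defB] | leB1] := ltnP 1 #|B|.
  move: Ba; rewrite defB setD1K // !inE nt_d => /andP[_ Sa].
  by rewrite groupMr // groupV.
have /cards1P[x defB]: #|B| == 1%N.
  by rewrite eqn_leq leB1; apply/card_gt0P; exists a.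
move: Ba; rewrite defB !inE => /eqP->.
(* For a singleton, [a = x]: [d^-1 * x = 1] means [d = x], while [d^-1 * x = x] would force
   [d = 1]. *)
rewrite -eq_mulVg1 -[X in _ || (_ == X)]mul1g (inj_eq (mulIg x)) invg_eq1.
by rewrite (negPf nt_d) orbF.
Qed.

(** A counted pair is determined by its first entry [a], since [b = d^-1 * a]. As the blocks cover
    [G^#], this [b] lies in another block exactly when it avoids [1 |: A j], which depends on [d]
    alone. *)
Lemma ext_diff_countE (gT : finGroupType) (G : {group gT}) (m : nat)
    (A : 'I_m -> {set gT}) (j : 'I_m) (d : gT) :
    (forall i i', i != i' -> [disjoint A i & A i']) ->
    cover [set A i | i : 'I_m] = G^# ->
    (1 < #|A j| -> exists S : {group gT}, A j = S^#) ->
    d \in G^# ->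
  ext_diff_count A j d = if d \in A j then 0 else #|A j|.
Proof.
move=> disjA covA subAj /setD1P[nt_d Gd].
have mem_cov x : (x \in G^#) = [exists i, x \in A i].
  rewrite -covA cover_imset; apply/bigcupP/existsP => [[i _ Ax] | [i Ax]];
  by exists i.
have others b :
    [exists i, (i != j) && (b \in A i)] = (b \in G^#) && (b \notin A j).
  rewrite mem_cov; apply/existsP/andP.
  - move=> [i /andP[ne_ij Ab]].
    split; first by apply/existsP; exists i.
    by rewrite (disjointFr (disjA _ _ ne_ij) Ab).
  - move=> [/existsP[i Ab] nAb].
    by exists i; rewrite Ab andbT; apply: contraNneq nAb => <-.
(* The condition on the right does not involve [a], so that set is [A j] or empty;
   [a |-> (a, d^-1 * a)] maps it bijectively onto the counted pairs. *)
have -> : ext_diff_count A j d = #|[set a in A j | d \notin A j]|.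
  have pair_inj : injective (fun a => (a, d^-1 * a)) by move=> a a' [].
  rewrite /ext_diff_count -(card_imset _ pair_inj).
  apply: eq_card => -[a b]; rewrite inE /= others.
  apply/and3P/imsetP => [[Aa /andP[Gb nAb] /eqP def_d] |
                         [a' /setIdP[Aa nAd] [-> ->]]].
    have def_b : b = d^-1 * a by rewrite -def_d invMg invgK mulgKV.
    exists a; last by rewrite def_b.
    rewrite inE Aa -(setD1_group_mem_divl subAj Aa nt_d) -def_b !inE negb_or nAb.
    by case/setD1P: Gb => ->.
  have /setD1P[_ Ga'] : a' \in G^# by rewrite mem_cov; apply/existsP; exists j.
  move: nAd; rewrite -(setD1_group_mem_divl subAj Aa nt_d) !inE negb_or.
  case/andP=> -> ->; rewrite groupM ?groupV //.
  by rewrite invMg invgK mulKVg eqxx.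
case: (d \in A j) => /=; [apply: eq_card0 | apply: eq_card] => a.
  by rewrite inE andbF.
by rewrite inE andbT.
Qed.

Theorem mainTheorem15 (gT : finGroupType) (G : {group gT}) (n m : nat)
    (k : 'I_m -> nat) (A : 'I_m -> {set gT})
    (hn : #|G| = n)
    (hk : forall i, #|A i| = k i)
    (hdisj : forall i j, i != j -> [disjoint A i & A j])
    (hpart : partition [set A i | i : 'I_m] G^#)
    (hsub : forall i, (1 < #|A i|)%N ->
       exists2 S : {group gT}, S \subset G & A i = S^#) :
  bimodal G A /\ is_RWEDF G n k (m%:R - 1)%R A.
Proof.
have [/eqP covA _ nA0] := and3P hpart.
have countE j d (Gd : d \in G^#) :
    ext_diff_count A j d = if d \in A j then 0 else #|A j|.
  by apply: (ext_diff_countE hdisj covA) => // /hsub[S _ defA]; exists S.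
(* A partition has no empty block, so each weight is a genuine inverse. *)
have k_gt0 i : (0 < k i)%N.
  by rewrite -hk card_gt0; apply: contraNneq nA0 => <-; apply: imset_f.
split=> [j d Gd | ]; first by rewrite countE //; case: ifP; [left | right].
split=> // [i | d Gd].
  apply: subset_trans (subsetDl G 1); rewrite -covA.
  by apply: (bigcup_max (A i)) => //; apply: imset_f.
have [j Aj_d] : exists j, d \in A j.
  by move: Gd; rewrite -covA cover_imset => /bigcupP[j _ Ad]; exists j.
rewrite (bigD1 j) //= countE // Aj_d GRing.mulr0 GRing.add0r.
rewrite (eq_bigr (fun=> 1%R)) => [ | i ne_ij].
  rewrite GRing.sumr_const cardC1 card_ord.
  (* The sum of ones is the truncated [m.-1]; it agrees with [m%:R - 1] because the index [j]
     witnesses [0 < m]. *)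
  by rewrite -[X in (X%:R - 1)%R](ltn_predK (ltn_ord j)) -GRing.natr1 GRing.addrK.
rewrite countE // (disjointFl (hdisj _ _ ne_ij) Aj_d) hk GRing.mulVf //.
by rewrite Num.Theory.pnatr_eq0 -lt0n.
Qed.
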